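(* Let $F_1,\dots,F_k$ be a $k$-MOFS$(n)$ and let $\emptyset\ne C\subseteq N(n)\times N(n)$. For $1\le i\le k$ let $C_i=C$ if $F_i$ agrees with $F_1$ on every cell of $C$ or disagrees with $F_1$ on every cell of $C$, and let $C_i=\emptyset$ otherwise. For $1\le i\le k$ and $a\in\{0,1\}$ let $V_{i,a}=\{(x,y)\in C: F_i[x,y]=a\}$. Then $T=(C_1,\dots,C_k)$ is a trade if and only if both of the following hold: (1) each row and each column of $F_1$ contains equally many zeros and ones among its cells that lie in $C$; (2) for each $j$ with $C_j=\emptyset$, $|V_{1,1}\cap V_{j,1}|=|V_{1,0}\cap V_{j,1}|$.
   Context: Let $N(n)=\{1,\dots,n\}$ and let $n$ be even. A (binary) frequency square of order $n$ is an $n\times n$ array indexed by $N(n)\times N(n)$ with entries in $\{0,1\}$ such that every row and every column contains exactly $n/2$ zeros and $n/2$ ones. Two frequency squares $F,G$ of order $n$ are orthogonal if for each $(a,b)\in\{0,1\}^2$ the number of cells $(r,c)$ with $(F[r,c],G[r,c])=(a,b)$ equals $n^2/4$. A $k$-MOFS$(n)$ is an ordered set $F_1,\dots,F_k$ of pairwise orthogonal frequency squares of order $n$. For such a set, a tuple $(C_1,\dots,C_k)$ of subsets of $N(n)\times N(n)$, not all empty, is switched by replacing $F_i[x,y]$ with $1-F_i[x,y]$ for every $(x,y)\in C_i$, for each $i$; the tuple is a trade if the result of switching is again a $k$-MOFS$(n)$. *)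

(* Defs.v *)
From mathcomp Require Import all_boot all_order all_algebra.
Set Implicit Arguments.
Unset Strict Implicit.
Unset Printing Implicit Defensive.

(* The symbols 0 and 1 are the booleans false and true; N(n) is 'I_n. *)
Definition square (n : nat) := 'M[bool]_n.

Definition cell (n : nat) := ('I_n * 'I_n)%type.

(* Halving and division by 4 are exact for even n, the only case of interest. *)
Definition frequency_square (n : nat) (A : square n) : Prop :=
  (forall (r : 'I_n) (a : bool), #|[set c : 'I_n | A r c == a]| = n./2) /\
  (forall (c : 'I_n) (a : bool), #|[set r : 'I_n | A r c == a]| = n./2).

Definition orthogonal_squares (n : nat) (A B : square n) : Prop :=
  forall a b : bool,
    #|[set p : cell n | (A p.1 p.2, B p.1 p.2) == (a, b)]| = n ^ 2 %/ 4.

Definition is_MOFS (k n : nat) (F : 'I_k -> square n) : Prop :=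
  (forall i, frequency_square (F i)) /\
  (forall i j, i != j -> orthogonal_squares (F i) (F j)).

Definition switch (k n : nat) (F : 'I_k -> square n)
    (T : 'I_k -> {set cell n}) : 'I_k -> square n :=
  fun i => (\matrix_(x, y)
    if (x, y) \in T i then ~~ F i x y else F i x y)%R.

Definition is_trade (k n : nat) (F : 'I_k -> square n)
    (T : 'I_k -> {set cell n}) : Prop :=
  (exists i, T i != set0) /\ is_MOFS (switch F T).

Definition agree_on (n : nat) (C : {set cell n}) (A B : square n) : bool :=
  [forall p in C, A p.1 p.2 == B p.1 p.2].

Definition disagree_on (n : nat) (C : {set cell n}) (A B : square n) : bool :=
  [forall p in C, A p.1 p.2 != B p.1 p.2].

(* The tuple (C_1, ..., C_k), with i1 the index of the reference square F_1. *)
Definition block_tuple (k n : nat) (F : 'I_k -> square n) (i1 : 'I_k)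
    (C : {set cell n}) : 'I_k -> {set cell n} :=
  fun i => if agree_on C (F i) (F i1) || disagree_on C (F i) (F i1)
           then C else set0.

(* V_{i,a}, for A = F_i. *)
Definition value_cells (n : nat) (C : {set cell n}) (A : square n) (a : bool)
    : {set cell n} :=
  [set p in C | A p.1 p.2 == a].

Definition balanced_on (n : nat) (C : {set cell n}) (A : square n) : Prop :=
  (forall r : 'I_n,
     #|[set c : 'I_n | ((r, c) \in C) && (A r c == false)]| =
     #|[set c : 'I_n | ((r, c) \in C) && (A r c == true)]|) /\
  (forall c : 'I_n,
     #|[set r : 'I_n | ((r, c) \in C) && (A r c == false)]| =
     #|[set r : 'I_n | ((r, c) \in C) && (A r c == true)]|).

(* Main.v *)
Require Import Defs.
From mathcomp Require Import all_boot all_order all_algebra.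
From mathcomp Require Import zify.

Set Implicit Arguments.
Unset Strict Implicit.
Unset Printing Implicit Defensive.

Import GRing.Theory.
Local Open Scope ring_scope.

(** Encode the symbol [a] as the sign [(-1) ^+ a].  Frequency squares are then
    the sign matrices with vanishing line sums, two frequency squares are
    orthogonal iff their entrywise product has total sum zero, and switching on
    [C] subtracts from each of these sums twice its part over [C].  Hence [T] is
    a trade iff the line sums of [F_1] over [C] vanish, and so does the sum over
    [C] of the product of [F_1] and [F_j] whenever [C_j] is empty; products of
    two squares that are both switched do not change.  Counting cells by pairs
    of symbols turns the last condition into (2), given (1). *)

Local Notation sg a := ((-1) ^+ nat_of_bool a : int).

(** * Counting values through sign sums *)

Section SignSums.
Variable T : finType.
Implicit Types (P : pred T) (f g : T -> bool).

Lemma card_set_sum P : #|[set x | P x]|%:Z = \sum_(x | P x) 1.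
Proof. by rewrite sumr_const cardsE natz. Qed.

(* Twice the indicator of [f x == a] is [1 + sg a * sg (f x)]. *)
Lemma card_value_sign P f a :
  2%:Z * #|[set x | P x && (f x == a)]|%:Z =
  \sum_(x | P x) 1 + sg a * \sum_(x | P x) sg (f x).
Proof.
rewrite card_set_sum !mulr_sumr -big_split big_mkcondr /=.
by apply: eq_bigr => x _; case: (f x); case: a.
Qed.

(** Four times the indicator of both equations is [(1 + sg a * sg (f x)) * (1 + sg b * sg (g x))];
    expand the product and sum. *)
Lemma card_values_sign P f g a b :
  4%:Z * #|[set x | [&& P x, f x == a & g x == b]]|%:Z =
  \sum_(x | P x) 1 + sg a * \sum_(x | P x) sg (f x)
  + sg b * \sum_(x | P x) sg (g x)
  + sg a * sg b * \sum_(x | P x) (sg (f x) * sg (g x)).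
Proof.
rewrite card_set_sum !mulr_sumr -!big_split big_mkcondr /=.
by apply: eq_bigr => x _; case: (f x); case: (g x); case: a; case: b.
Qed.

Lemma eq_card_values P f :
  #|[set x | P x && (f x == false)]| = #|[set x | P x && (f x == true)]| <->
  \sum_(x | P x) sg (f x) = 0.
Proof.
have := card_value_sign P f false; have := card_value_sign P f true.
by rewrite expr0 expr1; lia.
Qed.

Lemma sum_opp_on P (h : T -> int) :
  \sum_x (if P x then - h x else h x) = \sum_x h x - 2 * \sum_(x | P x) h x.
Proof.
rewrite (big_mkcond P) mulr_sumr -sumrB; apply: eq_bigr => x _.
by case: (P x); lia.
Qed.

End SignSums.

(** * Line sums and correlations of squares, and how switching changes them *)

Section Squares.
Variable n : nat.
Implicit Types (A B : square n) (C D : {set cell n}).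

(** Inner product of the two sign matrices, restricted to [C]. *)
Definition corr_on C A B : int :=
  \sum_(p in C) (sg (A p.1 p.2) * sg (B p.1 p.2)).

Lemma card_half_sign (n_even : ~~ odd n) (f : 'I_n -> bool) :
  (forall a, #|[set x | f x == a]| = n./2) <-> \sum_x sg (f x) = 0.
Proof.
have E a : 2%:Z * #|[set x | f x == a]|%:Z = n%:Z + sg a * \sum_x sg (f x).
  by rewrite (card_value_sign xpredT) sumr_const card_ord natz.
have := odd_double_half n; rewrite (negbTE n_even) add0n -mul2n => nE.
split=> [H|S0 a].
  by have := E true; have := E false; rewrite !H expr0 expr1; lia.
by have := E a; rewrite S0 mulr0; lia.
Qed.

Lemma frequency_squareP (n_even : ~~ odd n) A : frequency_square A <->
  (forall r, \sum_c sg (A r c) = 0) /\ (forall c, \sum_r sg (A r c) = 0).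
Proof.
rewrite /frequency_square; split=> -[H1 H2]; split=> x.
- exact/(card_half_sign n_even)/H1.
- exact/(card_half_sign n_even)/H2.
- exact/(card_half_sign n_even)/H1.
- exact/(card_half_sign n_even)/H2.
Qed.

Lemma balanced_onP C A : balanced_on C A <->
  (forall r, \sum_(c | (r, c) \in C) sg (A r c) = 0) /\
  (forall c, \sum_(r | (r, c) \in C) sg (A r c) = 0).
Proof.
rewrite /balanced_on; split=> -[H1 H2]; split=> x.
- exact/eq_card_values/H1.
- exact/eq_card_values/H2.
- exact/eq_card_values/H1.
- exact/eq_card_values/H2.
Qed.

Lemma frequency_square_sum (n_even : ~~ odd n) A :
  frequency_square A -> \sum_(p : cell n) sg (A p.1 p.2) = 0.
Proof.
move=> /(frequency_squareP n_even)[H _].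
by rewrite -(pair_bigA _ (fun r c => sg (A r c))) big1 // => r _; apply: H.
Qed.

Lemma balanced_on_sum C A :
  balanced_on C A -> \sum_(p in C) sg (A p.1 p.2) = 0.
Proof.
move=> /balanced_onP[H _].
transitivity (\sum_r \sum_(c | (r, c) \in C) sg (A r c)); last by rewrite big1.
by rewrite pair_big_dep; apply: eq_bigl => -[].
Qed.

(** The total sums of [A] and [B] vanish, so four times each count is [n ^ 2] plus or minus the
    correlation. *)
Lemma orthogonal_squaresP (n_even : ~~ odd n) A B :
  frequency_square A -> frequency_square B ->
  orthogonal_squares A B <-> corr_on setT A B = 0.
Proof.
move=> /(frequency_square_sum n_even) SA /(frequency_square_sum n_even) SB.
have E a b : 4%:Z * #|[set p : cell n | (A p.1 p.2, B p.1 p.2) == (a, b)]|%:Z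
    = (n ^ 2)%:Z + sg a * sg b * corr_on setT A B.
  rewrite (card_values_sign xpredT (fun p : cell n => A p.1 p.2)
    (fun p => B p.1 p.2)) SA SB !mulr0 !addr0 sumr_const card_prod card_ord natz.
  by rewrite mulnn; congr (_ + _ * _); apply: eq_bigl => p; rewrite inE.
(* As [n] is even, 4 divides [n ^ 2], so the truncated quotient is exact. *)
have n2E : (n ^ 2 %/ 4 * 4 = n ^ 2)%N.
  by apply/divnK/(@dvdn_exp2r 2 n 2); rewrite dvdn2.
rewrite /orthogonal_squares; split=> [H|S0 a b].
  by have := E false false; rewrite H !expr0; lia.
have := E a b; rewrite S0 mulr0; move: #|_| => c; lia.
Qed.

(** One component of [switch]: [switch F T i] is convertible to [switch_on (T i) (F i)]. *)
Definition switch_on C A : square n :=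
  \matrix_(x, y) if (x, y) \in C then ~~ A x y else A x y.

Lemma sign_switch_on C A x y :
  sg (switch_on C A x y) = if (x, y) \in C then - sg (A x y) else sg (A x y).
Proof. by rewrite mxE; case: ifP => // _; case: (A x y). Qed.

Lemma frequency_square_switch_on (n_even : ~~ odd n) C A :
  frequency_square A ->
  frequency_square (switch_on C A) <-> balanced_on C A.
Proof.
move=> /(frequency_squareP n_even)[R0 C0]; rewrite (frequency_squareP n_even) balanced_onP.
have ER r : (\sum_c sg (switch_on C A r c) == 0) =
    (\sum_(c | (r, c) \in C) sg (A r c) == 0).
  under eq_bigr do rewrite sign_switch_on.
  by rewrite (sum_opp_on (fun c => (r, c) \in C)) R0 sub0r oppr_eq0 mulf_eq0.
have EC c : (\sum_r sg (switch_on C A r c) == 0) =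
    (\sum_(r | (r, c) \in C) sg (A r c) == 0).
  under eq_bigr do rewrite sign_switch_on.
  by rewrite (sum_opp_on (fun r => (r, c) \in C)) C0 sub0r oppr_eq0 mulf_eq0.
split=> -[H1 H2]; split=> x; apply/eqP.
- by rewrite -ER H1.
- by rewrite -EC H2.
- by rewrite ER H1.
- by rewrite EC H2.
Qed.

Lemma corr_onC C A B : corr_on C A B = corr_on C B A.
Proof. by apply: eq_bigr => p _; rewrite mulrC. Qed.

Lemma corr_switch_both C D A B :
  corr_on D (switch_on C A) (switch_on C B) = corr_on D A B.
Proof.
apply: eq_bigr => p _; rewrite !sign_switch_on.
by case: ifP => // _; rewrite mulrNN.
Qed.

Lemma corr_switch_left C A B :
  corr_on setT (switch_on C A) (switch_on set0 B) =
  corr_on setT A B - 2 * corr_on C A B.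
Proof.
have full A' B' : corr_on setT A' B' =
    \sum_(p : cell n) (sg (A' p.1 p.2) * sg (B' p.1 p.2)).
  by apply: eq_bigl => p; rewrite inE.
rewrite !full -sum_opp_on; apply: eq_bigr => -[x y] _.
by rewrite !sign_switch_on inE /=; case: ifP => // _; rewrite mulNr.
Qed.

Lemma card_value_cellsI C A B a b :
  #|value_cells C A a :&: value_cells C B b| =
  #|[set p | [&& p \in C, A p.1 p.2 == a & B p.1 p.2 == b]]|.
Proof.
by apply: eq_card => p; rewrite !inE; case: (p \in C); rewrite //= andbF.
Qed.

(** Subtract the expansions of the two counts: the sum of [B] over [C] cancels, the sum of [A]
    vanishes by balance, and only a multiple of the correlation remains. *)
Lemma eq_card_value_cells C A B : balanced_on C A ->
  #|value_cells C A true :&: value_cells C B true| =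
  #|value_cells C A false :&: value_cells C B true| <-> corr_on C A B = 0.
Proof.
move=> /balanced_on_sum SA; rewrite !card_value_cellsI.
have E a := card_values_sign (mem C)
  (fun p : cell n => A p.1 p.2) (fun p => B p.1 p.2) a true.
have := E true; have := E false.
by rewrite /= SA -/(corr_on C A B) expr0 expr1; lia.
Qed.

(** A single global sign [e] covers both cases, so that sums over [C] merely scale by it. *)
Lemma agree_or_disagree_sign C A B : agree_on C A B || disagree_on C A B ->
  exists e : bool, forall p, p \in C -> sg (A p.1 p.2) = sg e * sg (B p.1 p.2).
Proof.
case/orP=> /forall_inP H; [exists false|exists true] => p /H.
  by move/eqP->; rewrite mul1r.
by case: (A _ _); case: (B _ _).
Qed.

Lemma balanced_on_sign C A B (e : bool) :
  (forall p, p \in C -> sg (A p.1 p.2) = sg e * sg (B p.1 p.2)) ->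
  balanced_on C B -> balanced_on C A.
Proof.
move=> H /balanced_onP[R0 C0]; apply/balanced_onP; split=> x.
  rewrite (eq_bigr (fun c => sg e * sg (B x c))) => [|c /H//].
  by rewrite -mulr_sumr R0 mulr0.
rewrite (eq_bigr (fun r => sg e * sg (B r x))) => [|r /H//].
by rewrite -mulr_sumr C0 mulr0.
Qed.

Lemma corr_on_sign C A A' B (e : bool) :
  (forall p, p \in C -> sg (A p.1 p.2) = sg e * sg (A' p.1 p.2)) ->
  corr_on C A B = sg e * corr_on C A' B.
Proof.
by move=> H; rewrite /corr_on mulr_sumr; apply: eq_bigr => p /H->; rewrite mulrA.
Qed.

Lemma balanced_on_set0 A : balanced_on set0 A.
Proof. by apply/balanced_onP; split=> x; rewrite big1 // => y; rewrite inE. Qed.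

End Squares.

Lemma block_tuple_ref k n (F : 'I_k -> square n) i C : block_tuple F i C i = C.
Proof.
by rewrite /block_tuple; have -> : agree_on C (F i) (F i) by apply/forall_inP.
Qed.

Local Close Scope ring_scope.

Theorem theorem4p1 (k n : nat) (k_gt0 : 0 < k) (n_even : ~~ odd n)
    (F : 'I_k -> square n) (F_MOFS : is_MOFS F)
    (C : {set cell n}) (C_neq0 : C != set0) :
  is_trade F (block_tuple F (Ordinal k_gt0) C) <->
  balanced_on C (F (Ordinal k_gt0)) /\
  (forall j : 'I_k, block_tuple F (Ordinal k_gt0) C j = set0 ->
     #|value_cells C (F (Ordinal k_gt0)) true :&: value_cells C (F j) true| =
     #|value_cells C (F (Ordinal k_gt0)) false :&: value_cells C (F j) true|).
Proof.
set i1 := Ordinal k_gt0; set T := block_tuple F i1 C.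
have Ti1 : T i1 = C := block_tuple_ref F i1 C.
case: F_MOFS => freqF orthF.
have freqS i : frequency_square (switch F T i) <-> balanced_on (T i) (F i).
  exact: frequency_square_switch_on.
have corrF i j : i != j -> corr_on setT (F i) (F j) = 0%R.
  by move=> /orthF H; apply/orthogonal_squaresP.
split.
  case=> _ [freqT orthT].
  have bal : balanced_on C (F i1) by rewrite -Ti1; apply/freqS.
  split=> // j Tj; apply/eq_card_value_cells => //.
  (* The block of [j] is empty, whereas that of [i1] is the nonempty [C]. *)
  have ij : i1 != j.
    by apply: contra_neq C_neq0 => ij; rewrite -Ti1 ij Tj.
  have /(orthogonal_squaresP n_even (freqT _) (freqT _)) := orthT _ _ ij.
  rewrite -[switch F T i1]/(switch_on (T i1) (F i1)).
  rewrite -[switch F T j]/(switch_on (T j) (F j)).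
  by rewrite Ti1 Tj corr_switch_left corrF //; lia.
case=> bal cond.
have T_cases i : T i = set0 \/ T i = C /\ exists e : bool, forall p, p \in C ->
    sg (F i p.1 p.2) = (sg e * sg (F i1 p.1 p.2))%R.
  rewrite /T /block_tuple; case: ifP => [H|_]; [right|by left].
  by split=> //; apply: agree_or_disagree_sign.
have freqT i : frequency_square (switch F T i).
  apply/freqS; case: (T_cases i) => [->|[-> [e He]]].
    exact: balanced_on_set0.
  exact: balanced_on_sign He bal.
(* On [C] the signs of [F i] are those of [F i1] up to [e], so condition (2), stated for [F i1] and
   [F j], also annihilates the correlation of [F i] and [F j] over [C]. *)
have mixed i j : i != j -> T i = C -> T j = set0 ->
    (exists e : bool, forall p, p \in C ->
       sg (F i p.1 p.2) = (sg e * sg (F i1 p.1 p.2))%R) ->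
    corr_on setT (switch_on C (F i)) (switch_on set0 (F j)) = 0%R.
  move=> ij Ti Tj [e He]; rewrite corr_switch_left corrF //.
  rewrite (corr_on_sign _ He).
  by have /(eq_card_value_cells (F j) bal)-> := cond _ Tj; rewrite !mulr0 subr0.
split; first by exists i1; rewrite Ti1.
split=> // i j ij; apply/orthogonal_squaresP => //.
rewrite -[switch F T i]/(switch_on (T i) (F i)).
rewrite -[switch F T j]/(switch_on (T j) (F j)).
case: (T_cases i) (T_cases j) => [Ti|[Ti ei]] [Tj|[Tj ej]]; rewrite Ti Tj.
(* Two unswitched squares count as both switched on [set0]. *)
- by rewrite corr_switch_both corrF.
- by rewrite corr_onC mixed // eq_sym.
- exact: mixed.
- by rewrite corr_switch_both corrF.
Qed.
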